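(* Let $m\ge 0$ be an integer. If $n=6m$ or $n=6m+2$, then $C_{n}$ is a $\mathbb{Z}/2$-linear combination of the $C_{k}$ with $0\le k<n$.
   Context: The polynomials $C_{n}\in \mathbb{Z}/2[t]$, $n\ge 0$, are defined by the recurrence $C_{n+6}=C_{n+5}+(t^{6}+t^{5}+t^{2}+t)C_{n}+t^{n}(t^{2}+t)$ for $n\ge 0$, with $C_{0}=0$, $C_{1}=1$, $C_{2}=1$, $C_{3}=t$, $C_{4}=t^{2}$, $C_{5}=t^{4}+t^{2}+t$. The empty linear combination is $0$. *)

(* Defs.v *)
From HB Require Import structures.
From mathcomp Require Import all_boot all_order all_algebra.

Set Implicit Arguments.
Unset Strict Implicit.
Unset Printing Implicit Defensive.

Import GRing.Theory.
Local Open Scope ring_scope.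

(* The variable t is 'X, and Z/2 is 'F_2. In the last clause the argument is
   n + 6, and n5 stands for n + 5. *)
Fixpoint Cpoly (k : nat) : {poly 'F_2} :=
  match k with
  | 0 => 0
  | 1 => 1
  | 2 => 1
  | 3 => 'X
  | 4 => 'X^2
  | 5 => 'X^4 + 'X^2 + 'X
  | (n.+1.+4 as n5).+1 =>
      Cpoly n5 + ('X^6 + 'X^5 + 'X^2 + 'X) * Cpoly n + 'X^n * ('X^2 + 'X)
  end.

(* Main.v *)
From HB Require Import structures.
Require Import Defs.
From mathcomp Require Import all_boot all_order all_algebra.
From mathcomp Require Import ring zify.

(** A relation expressing C_n through the earlier C_k is the same thing as a
    polynomial of degree n in the kernel of the linear map [Cmap] that sends
    t^k to C_k ([Cpoly_dep]).  So kernel elements of degrees 6m and 6m + 2 are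
    wanted, and they can be found among the polynomials in u = t^2 + t.

    Put f = t^5 (t + 1), and let P = t (t + 1)^5 be its image under the
    substitution of t + 1 for t.  As f + P = u, the recurrence defining C_n
    says exactly that Cmap (f g) = P Cmap g + u g for every g ([Cmap_fM]).  The
    element u is fixed by that substitution; it is the trace f + P, and u^6 is
    the norm f P, so u^6 = f^2 + f u.  Applying this rule
    twice, the inhomogeneous terms cancel and leave the homogeneous recurrence
    Cmap (u^(i+6)) = P Cmap (u^(i+1)) + P^2 Cmap (u^i) ([Cmap_u_rec]).

    With Q = (t + 1)^2, the six initial values are 0, 0, Q, 0, 0, P Q.  Hence all
    the Cmap (u^i) are multiples of Q by polynomials in P.  Let V_j be the span
    of Q, P Q, ..., P^(j-1) Q.  By induction Cmap (u^(3j)) and Cmap (u^(3j+1))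
    lie in V_j, while Cmap (u^(3j+2)) is P^j Q modulo V_j ([Cmap_u_Pspan]).  By
    triangularity the u^(3i+2) with i < j already have images spanning V_j
    ([Pspan_Cmap]).  So u^(3m) and u^(3m+1), of degrees 6m and 6m + 2 in t, can
    be corrected by terms of degree less than 6m to lie in the kernel. *)

Import GRing.Theory.
Local Open Scope ring_scope.

Local Notation t := ('X : {poly 'F_2}).
Local Notation f := (t ^+ 6 + t ^+ 5).
Local Notation P := (t ^+ 6 + t ^+ 5 + t ^+ 2 + t).
Local Notation u := (t ^+ 2 + t).
Local Notation Q := (t ^+ 2 + 1).

Definition Cmap (g : {poly 'F_2}) : {poly 'F_2} :=
  \sum_(i < size g) g`_i *: Cpoly i.

Lemma Cmap_wide {n} {g : {poly 'F_2}} :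
  (size g <= n)%N -> Cmap g = \sum_(i < n) g`_i *: Cpoly i.
Proof.
move=> le_gn; rewrite /Cmap (big_ord_widen n (fun i => g`_i *: Cpoly i)) //.
rewrite big_mkcond; apply: eq_bigr => i _.
by case: ltnP => // le_gi; rewrite nth_default ?scale0r.
Qed.

Lemma Cmap_is_linear : linear Cmap.
Proof.
move=> a g h; set n := maxn (size g) (size h).
have le_gn : (size g <= n)%N by rewrite leq_maxl.
have le_hn : (size h <= n)%N by rewrite leq_maxr.
have le_agn : (size (a *: g) <= n)%N by rewrite (leq_trans (size_scale_leq _ _)).
rewrite (@Cmap_wide n (a *: g + h)); last first.
  by rewrite (leq_trans (size_polyD _ _)) // geq_max le_agn.
rewrite (Cmap_wide le_gn) (Cmap_wide le_hn) scaler_sumr -big_split /=.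
by apply: eq_bigr => i _; rewrite coefD coefZ scalerDl scalerA.
Qed.

HB.instance Definition _ :=
  GRing.isLinear.Build 'F_2 {poly 'F_2} {poly 'F_2} *:%R Cmap Cmap_is_linear.

Lemma Cmap_Xn n : Cmap ('X^n) = Cpoly n.
Proof.
rewrite (@Cmap_wide n.+1) ?size_polyXn // big_ord_recr /= big1 ?add0r.
  by rewrite coefXn eqxx scale1r.
by move=> i _; rewrite coefXn ltn_eqF ?scale0r.
Qed.

Lemma CpolyE n :
  Cpoly n.+1.+4.+1 = Cpoly n.+1.+4 + P * Cpoly n + t ^+ n * u.
Proof. by []. Qed.

Lemma poly_char2 : 2%:R = 0 :> {poly 'F_2}.
Proof. by rewrite -polyC_natr (_ : 2%:R = 0 :> 'F_2) //; apply: val_inj. Qed.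

(** Multiplying t^n by f gives t^(n+6) + t^(n+5), so on powers of t this is the
    recurrence for C_n with C_(n+5) moved to the left-hand side. *)
Lemma Cmap_fM g : Cmap (f * g) = P * Cmap g + u * g.
Proof.
rewrite -[g]coefK poly_def [f * _]mulr_sumr [u * _]mulr_sumr !linear_sum /= mulr_sumr.
rewrite -big_split /=.
apply: eq_bigr => i _; rewrite -!scalerAr !linearZ /= -scalerAr -scalerDr /=.
congr (_ *: _); rewrite mulrDl -!exprD linearD /= !Cmap_Xn.
rewrite -[(6 + i)%N]/(i.+1.+4.+1) CpolyE; ring: poly_char2.
Qed.

(* Powers of u are expanded by iterating Frobenius: no coefficient then exceeds
   2, and rewriting with 2 = 0 is all that normalization needs. *)
Lemma u_exp2 : u ^+ 2 = t ^+ 4 + t ^+ 2.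
Proof. by ring: poly_char2. Qed.

Lemma u_exp4 : u ^+ 4 = t ^+ 8 + t ^+ 4.
Proof. by rewrite (exprM _ 2 2) u_exp2; ring: poly_char2. Qed.

(** The quadratic equation of f over the polynomials in u: f has trace
    f + P = u and norm f P = u^6. *)
Lemma u_exp6 : u ^+ 6 = f ^+ 2 + f * u.
Proof. by rewrite (exprD _ 4 2) u_exp4 u_exp2; ring: poly_char2. Qed.

(** Expanding with [Cmap_fM], the inhomogeneous contributions add up to
    (P + f + u) u g, which vanishes since P = f + u. *)
Lemma Cmap_u6M g : Cmap (u ^+ 6 * g) = P * Cmap (u * g) + P ^+ 2 * Cmap g.
Proof.
rewrite u_exp6 mulrDl expr2 -!mulrA linearD /= !Cmap_fM.
(* Grouped as f + u, P makes the identity hold for arbitrary f and u. *)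
rewrite -[P]addrA; move: f u (Cmap _) (Cmap _) => a b x y.
by ring: poly_char2.
Qed.

(** The span of the P^i Q with i < j, encoded by the polynomial b of
    coefficients so that j bounds a size. *)
Definition Pspan j (z : {poly 'F_2}) :=
  exists2 b : {poly 'F_2}, (size b <= j)%N & z = (b \Po P) * Q.

Lemma Pspan0 j : Pspan j 0.
Proof. by exists 0; rewrite ?size_poly0 // comp_poly0 mul0r. Qed.

Lemma PspanD {j y z} : Pspan j y -> Pspan j z -> Pspan j (y + z).
Proof.
move=> [b le_bj ->] [c le_cj ->]; exists (b + c).
  by rewrite (leq_trans (size_polyD _ _)) // geq_max le_bj.
by rewrite comp_polyD mulrDl.
Qed.

Lemma Pspan_leq {i j z} : (i <= j)%N -> Pspan i z -> Pspan j z.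
Proof. by move=> le_ij [b le_bi ->]; exists b => //; apply: leq_trans le_ij. Qed.

Lemma PspanPM {j z} : Pspan j z -> Pspan j.+1 (P * z).
Proof.
move=> [b le_bj ->]; exists ('X * b).
  by rewrite (leq_trans (size_polyMleq _ _)) // size_polyX.
by rewrite comp_polyM comp_polyX mulrA.
Qed.

Lemma Pspan_Xn j : Pspan j.+1 (P ^+ j * Q).
Proof. by exists 'X^j; rewrite ?size_polyXn // comp_Xn_poly. Qed.

(** Reducing u^3, u^4 and u^5 modulo f lets [Cmap_fM] give their images from
    C_0, ..., C_5 alone. *)
Lemma Cmap_u_base :
  [/\ Cmap (u ^+ 0) = 0, Cmap (u ^+ 1) = 0, Cmap (u ^+ 2) = Q
    & [/\ Cmap (u ^+ 3) = 0, Cmap (u ^+ 4) = 0 & Cmap (u ^+ 5) = P * Q]].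
Proof.
have C0 : Cmap 1 = 0 by rewrite -(expr0 t) Cmap_Xn.
have C1 : Cmap u = 0.
  by rewrite linearD /= -[X in _ + Cmap X]expr1 !Cmap_Xn /=; ring: poly_char2.
have C2 : Cmap (u ^+ 2) = Q.
  by rewrite u_exp2 linearD /= !Cmap_Xn.
split=> //; split.
- have -> : u ^+ 3 = f * 1 + (t ^+ 4 + t ^+ 3).
    by rewrite exprS u_exp2; ring: poly_char2.
  rewrite !linearD /= Cmap_fM C0 !Cmap_Xn /=; ring: poly_char2.
- have -> : u ^+ 4 = f * u + f * 1 + (t ^+ 5 + t ^+ 4).
    by rewrite u_exp4; ring: poly_char2.
  rewrite 3!linearD /= !Cmap_fM C1 C0 !Cmap_Xn /=.
  (* The four summands each contribute one t^2. *)
  have char4 : 4%:R = 0 :> {poly 'F_2} by rewrite (natrM _ 2 2) poly_char2 mul0r.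
  ring: poly_char2 char4.
- have -> : u ^+ 5 = f * t ^+ 4 + f * 1.
    by rewrite exprS u_exp4; ring: poly_char2.
  rewrite linearD /= !Cmap_fM C0 !Cmap_Xn /=; ring: poly_char2.
Qed.

Lemma Cmap_u_rec i :
  Cmap (u ^+ (i + 6)) = P * Cmap (u ^+ i.+1) + P ^+ 2 * Cmap (u ^+ i).
Proof. by rewrite exprD mulrC Cmap_u6M -exprS. Qed.

(** The recurrence takes u^(3j+6) to u^(3j+1) and u^(3j), u^(3j+7) to u^(3j+2)
    and u^(3j+1), and u^(3j+8) to u^(3j+3) and u^(3j+2).  Only the
    term P^2 Cmap (u^(3j+2)) can contribute P^(j+2) Q. *)
Lemma Cmap_u_Pspan j :
  [/\ Pspan j (Cmap (u ^+ (3 * j))), Pspan j (Cmap (u ^+ (3 * j + 1)))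
    & Pspan j (Cmap (u ^+ (3 * j + 2)) - P ^+ j * Q)].
Proof.
have [b0 b1 b2 [b3 b4 b5]] := Cmap_u_base.
elim/ltn_ind: j => -[|[|j]] IH.
- by rewrite b0 b1 b2 mul1r subrr; split; apply: Pspan0.
- by rewrite b3 b4 b5 expr1 subrr; split; apply: Pspan0.
have [A0 A1 A2] := IH j (leqnSn j.+1).
have [B0 _ _] := IH j.+1 (leqnn _).
have P2 z : Pspan j z -> Pspan j.+2 (P ^+ 2 * z).
  by move=> /PspanPM/PspanPM; rewrite mulrA expr2.
have E2 : Pspan j.+1 (Cmap (u ^+ (3 * j + 2))).
  rewrite -[Cmap _](subrK (P ^+ j * Q)).
  by apply: PspanD _ (Pspan_Xn j); apply: Pspan_leq A2.
split.
- rewrite (_ : 3 * j.+2 = 3 * j + 6)%N; last by lia.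
  rewrite Cmap_u_rec -[(3 * j).+1]addn1; apply: PspanD _ (P2 _ A0).
  by apply: Pspan_leq (PspanPM A1).
- rewrite (_ : 3 * j.+2 + 1 = 3 * j + 1 + 6)%N; last by lia.
  rewrite Cmap_u_rec -addnS; apply: PspanD _ (P2 _ A1).
  exact: PspanPM E2.
- rewrite (_ : 3 * j.+2 + 2 = 3 * j + 2 + 6)%N; last by lia.
  rewrite Cmap_u_rec (_ : (3 * j + 2).+1 = 3 * j.+1)%N; last by lia.
  have split_lead p x y q :
      x + p ^+ 2 * y - p ^+ j.+2 * q = x + p ^+ 2 * (y - p ^+ j * q) :> {poly 'F_2}.
    by rewrite (exprD _ 2 j) mulrBr !mulrA addrA.
  rewrite split_lead.
  by apply: PspanD _ (P2 _ A2); apply: PspanPM B0.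
Qed.

Lemma size_uX i : size (u ^+ i) = (2 * i).+1.
Proof.
have sz_u : size u = 3.
  by rewrite size_polyDl ?size_polyXn ?size_polyX.
have u_neq0 : u ^+ i != 0 by rewrite expf_neq0 // -size_poly_eq0 sz_u.
by rewrite -[LHS]prednK ?size_exp ?sz_u // lt0n size_poly_eq0.
Qed.

Lemma lead_coef_uX i : lead_coef (u ^+ i) = 1.
Proof.
by rewrite lead_coef_exp lead_coefDl ?size_polyXn ?size_polyX // lead_coefXn expr1n.
Qed.

(** The image of u^(3j+2), of degree 6j + 4 < 6(j + 1), supplies the new
    generator P^j Q of the span up to elements of the previous span, which
    are images by induction. *)
Lemma Pspan_Cmap {j z} :
  Pspan j z -> exists2 g : {poly 'F_2}, (size g <= 6 * j)%N & Cmap g = z.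
Proof.
elim: j z => [|j IH] z [b le_bj ->].
  move: le_bj; rewrite leqn0 size_poly_eq0 => /eqP->.
  by exists 0; rewrite ?size_poly0 // linear0 comp_poly0 mul0r.
have [_ _ E2] := Cmap_u_Pspan j.
(* The b' part and the error of u^(3j+2) both lie in the previous span. *)
set a := b`_j; pose b' := b - a *: 'X^j.
have b'_j : (size b' <= j)%N.
  apply/leq_sizeP => i; rewrite leq_eqVlt => /predU1P[<-|lt_ji].
    by rewrite coefB coefZ coefXn eqxx mulr1 subrr.
  rewrite coefB coefZ coefXn gtn_eqF // mulr0 subr0.
  by rewrite nth_default // (leq_trans le_bj).
have [g1 sz1 Cg1] := IH ((b' \Po P) * Q) (ex_intro2 _ _ b' b'_j erefl).
have [g2 sz2 Cg2] := IH _ E2.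
exists (g1 + a *: (u ^+ (3 * j + 2) - g2)).
  rewrite (leq_trans (size_polyD _ _)) // geq_max (leq_trans sz1) ?leq_mul2l //=.
  rewrite (leq_trans (size_scale_leq _ _)) // (leq_trans (size_polyD _ _)) //.
  by rewrite geq_max size_polyN size_uX (leq_trans sz2) ?leq_mul2l //=; lia.
rewrite linearD linearZ linearB /= Cg1 Cg2 subKr.
by rewrite /b' comp_polyB comp_polyZ comp_Xn_poly scalerAl -mulrDl subrK.
Qed.

Lemma Cpoly_dep {n} {h : {poly 'F_2}} :
  size h = n.+1 -> lead_coef h = 1 -> Cmap h = 0 ->
  exists c : 'I_n -> 'F_2, Cpoly n = \sum_(k < n) c k *: Cpoly k.
Proof.
move=> sz_h; rewrite lead_coefE sz_h /= => h_n.
rewrite /Cmap sz_h big_ord_recr /= h_n scale1r => /eqP.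
rewrite addrC addr_eq0 => /eqP->; exists (fun k => - h`_k).
by rewrite -sumrN; apply: eq_bigr => i _; rewrite scaleNr.
Qed.

Theorem theorem2p11 (m n : nat) (hn : n = (6 * m)%N \/ n = (6 * m + 2)%N) :
  exists c : 'I_n -> 'F_2, Cpoly n = \sum_(k < n) c k *: Cpoly k.
Proof.
have [E0 E1 _] := Cmap_u_Pspan m.
have [i def_n Ei] : exists2 i, n = (2 * i)%N & Pspan m (Cmap (u ^+ i)).
  by case: hn => ->; [exists (3 * m)%N | exists (3 * m + 1)%N] => //; lia.
have [g sz_g Cg] := Pspan_Cmap Ei.
have lt_g : (size (- g) < size (u ^+ i))%N.
  by rewrite size_polyN size_uX -def_n ltnS (leq_trans sz_g) //; lia.
apply: (@Cpoly_dep _ (u ^+ i - g)).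
- by rewrite size_polyDl // size_uX def_n.
- by rewrite lead_coefDl // lead_coef_uX.
- by rewrite linearB /= Cg subrr.
Qed.
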